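(* Let $m\ge 2$, let $r_1,\ldots,r_m$ be positive integers, let $k$ be a positive integer, and assume that $$\sum_{i=1}^m \frac{1}{r_i+1}=m-k.$$ Let $B=B(k;r_1,\ldots,r_m)$ be the weighted star matrix, of size $D=1+\sum_{i=1}^m r_i$. Put $N_i=r_i+1$ and $s=\operatorname{lcm}(N_1,\ldots,N_m)$. Then a primitive positive kernel vector of $B$ is given, up to a common divisor of its entries, by the vector whose central coordinate is $s$ and whose coordinates on the $i$-th arm are $$c_{i,j}=\frac{s}{r_i+1}\,j,\qquad j=1,\ldots,r_i,\quad i=1,\ldots,m.$$ The corresponding Coxeter number is $$h=s+\sum_{i=1}^m\sum_{j=1}^{r_i}c_{i,j}=s\left(1+\frac12\sum_{i=1}^m r_i\right)=\frac{s}{2}(D+1).$$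
   Context: For a positive integer $r$, $A_r$ denotes the Cartan matrix of type $A_r$: the $r\times r$ tridiagonal matrix with all diagonal entries equal to $2$ and all entries immediately above and below the diagonal equal to $-1$ (so $A_1=(2)$). For each $i$, let $v_i\in\mathbb{Z}^{r_i}$ be the column vector whose entries are all zero except the last one, which is $-1$. The weighted star matrix is the symmetric integer matrix of size $D=1+\sum_{i=1}^m r_i$ $$B(k;r_1,\ldots,r_m)=\begin{pmatrix} A_{r_1}&0&\cdots&0&v_1\\ 0&A_{r_2}&\cdots&0&v_2\\ \vdots&\vdots&\ddots&\vdots&\vdots\\ 0&0&\cdots&A_{r_m}&v_m\\ v_1^t&v_2^t&\cdots&v_m^t&k\end{pmatrix}.$$ The central coordinate of a vector is its last coordinate (the row containing $k$). The coordinates on the $i$-th arm are those of the block $A_{r_i}$, numbered $j=1,\ldots,r_i$ in the order of that block, so that $j=r_i$ is the position adjacent to the central vertex. When $B$ is of affine type (positive semidefinite of corank one with every proper principal submatrix positive definite), its kernel is one-dimensional and generated by a strictly positive vector; the primitive integral positive generator (integer entries with greatest common divisor $1$) is called the vector of Coxeter labels, and the sum of its coordinates is called the Coxeter number. *)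

(* Defs.v *)
From mathcomp Require Import all_boot all_order all_algebra.
From mathcomp Require Import reals.
Set Implicit Arguments.
Unset Strict Implicit.
Unset Printing Implicit Defensive.
Import Order.TTheory GRing.Theory Num.Theory.
Local Open Scope ring_scope.

Definition cartanA (r : nat) : 'M[int]_r :=
  \matrix_(i, j) (if i == j then 2
                  else if (i.+1 == j :> nat) || (j.+1 == i :> nat) then -1
                  else 0).

Definition arm_vec (r : nat) : 'cV[int]_r :=
  \col_(j < r) (if j.+1 == r then -1 else 0).

Definition star_mx (m : nat) (k : nat) (r : 'I_m -> nat) :
    'M[int]_(\sum_i r i + 1) :=
  block_mx (\mxdiag_i cartanA (r i))    (\mxcol_i arm_vec (r i))
           (\mxcol_i arm_vec (r i))^T   (k%:Z)%:M.

Definition qform (R : realType) (n : nat) (B : 'M[R]_n) (x : 'cV[R]_n) : R :=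
  (x^T *m B *m x) 0 0.

Definition pos_semidef (R : realType) (n : nat) (B : 'M[R]_n) : Prop :=
  B^T = B /\ forall x : 'cV[R]_n, 0 <= qform B x.

Definition pos_def (R : realType) (n : nat) (B : 'M[R]_n) : Prop :=
  B^T = B /\ forall x : 'cV[R]_n, x != 0 -> 0 < qform B x.

Definition principal_submx (R : realType) (n : nat) (B : 'M[R]_n)
    (J : {set 'I_n}) : 'M[R]_#|J| :=
  mxsub (fun i : 'I_#|J| => enum_val i) (fun i : 'I_#|J| => enum_val i) B.

Definition affine_type (R : realType) (n : nat) (B : 'M[R]_n) : Prop :=
  [/\ pos_semidef B,
      (\rank B).+1 = n
    & forall J : {set 'I_n}, J \proper [set: 'I_n] ->
        pos_def (principal_submx B J)].

(* Definiteness and corank refer to B as a real matrix; since an affine type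
   matrix has a one-dimensional kernel, the conditions on v determine it. *)
Definition coxeter_labels (R : realType) (n : nat) (B : 'M[int]_n)
    (v : 'cV[int]_n) : Prop :=
  [/\ affine_type (map_mx intr B : 'M[R]_n),
      B *m v = 0,
      forall i, 0 < v i ord0
    & \big[gcdn/0%N]_i `|v i ord0|%N = 1%N].

Definition coxeter_number (R : realType) (n : nat) (B : 'M[int]_n)
    (h : int) : Prop :=
  exists2 v : 'cV[int]_n, coxeter_labels R B v & h = \sum_i v i ord0.

Definition star_lcm (m : nat) (r : 'I_m -> nat) : nat :=
  \big[lcmn/1%N]_i (r i).+1.

(* The natural number division is exact; j is numbered from 1 here. *)
Definition star_coord (m : nat) (r : 'I_m -> nat) (i : 'I_m) (j : nat) : nat :=
  (star_lcm r %/ (r i).+1 * j)%N.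

Definition star_vec (m : nat) (r : 'I_m -> nat) : 'cV[int]_(\sum_i r i + 1) :=
  col_mx (\mxcol_i \col_(j < r i) (star_coord r i j.+1)%:Z)
         ((star_lcm r)%:Z)%:M.

(* Main.v *)
Require Import Defs.
From mathcomp Require Import all_boot all_order all_algebra.
From mathcomp Require Import reals ring zify.
Set Implicit Arguments.
Unset Strict Implicit.
Unset Printing Implicit Defensive.
Import Order.TTheory GRing.Theory Num.Theory.
Local Open Scope ring_scope.

(** Let u be the vector with central coordinate s and coordinates (s / N_i) j on
    the arms. Three facts give everything.

    u is in the kernel. On an arm u is an arithmetic progression that would take
    the value 0 one step before the arm and takes the value s at the centre, so
    the Cartan matrix, a second difference, kills it (cartanA_linear). The
    central row of the product is k s - sum_i (s / N_i) r_i; since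
    (s / N_i) r_i = s - s / N_i, the hypothesis on the sum of the inverses of
    the N_i says that it vanishes (central_equation).

    u is already primitive, so that its coordinate sum is the Coxeter number. If
    d divides every entry it divides each s / N_i, the first entry of arm i;
    then each N_i divides s / d, hence so does their least common multiple s,
    and d = 1 (gcd_steps).

    The matrix is of affine type. This is a general fact on symmetric matrices
    with nonpositive off-diagonal entries, connected graph and a positive kernel
    vector u (positive_kernel_affine): the quadratic form at x is
      - 1/2 sum_(i, j) B_ij u_i u_j (x_i / u_i - x_j / u_j)^2,
    a sum of nonnegative terms, so that it vanishes only if x / u is constant
    along every edge, hence constant. The kernel is therefore the line of u, and
    a nonzero x with a zero coordinate has a positive value, which is
    definiteness of the proper principal submatrices. The graph of the star
    matrix is connected because every vertex of an arm leads to the centre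
    (star_connected).

    The two closed forms of the Coxeter number come from summing the arithmetic
    progressions: arm i contributes (s / N_i) r_i (r_i + 1) / 2 = s r_i / 2. *)

(** * Symmetric matrices with a positive kernel vector *)

Section PositiveKernelVector.
Variables (R : realType) (n : nat) (B : 'M[R]_n) (u : 'cV[R]_n).
Hypothesis B_sym : B^T = B.
Hypothesis u_gt0 : forall i, 0 < u i 0.
Hypothesis Bu0 : B *m u = 0.

Lemma qformE (x : 'cV[R]_n) :
  qform B x = \sum_i \sum_j B i j * x i 0 * x j 0.
Proof.
rewrite /qform mxE exchange_big /=; apply: eq_bigr => j _.
rewrite mxE mulr_suml; apply: eq_bigr => i _.
by rewrite mxE (mulrC (x i 0)).
Qed.

(** The square expands into a mixed term, which is the form itself, and two pure
    terms, in each of which one of the two sums produces an entry of B u = 0. *)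
Lemma qform_sum_sqr (x : 'cV[R]_n) :
  qform B x = - 2^-1 * \sum_i \sum_j
    B i j * u i 0 * u j 0 * (x i 0 / u i 0 - x j 0 / u j 0) ^+ 2.
Proof.
have u_neq0 i : u i 0 != 0 by rewrite gt_eqF.
have row0 i : \sum_j B i j * u j 0 = 0.
  by have /matrixP/(_ i 0) := Bu0; rewrite !mxE.
have diag0 : \sum_i \sum_j B i j * u i 0 * u j 0 * (x i 0 / u i 0) ^+ 2 = 0.
  rewrite big1 // => i _.
  rewrite (eq_bigr (fun j => (B i j * u j 0) * (u i 0 * (x i 0 / u i 0) ^+ 2))).
    by rewrite -mulr_suml row0 mul0r.
  by move=> j _; ring.
have diag0' : \sum_i \sum_j B i j * u i 0 * u j 0 * (x j 0 / u j 0) ^+ 2 = 0.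
  rewrite exchange_big /= -[RHS]diag0; apply: eq_bigr => j _.
  apply: eq_bigr => i _.
  by rewrite -{1}B_sym mxE (mulrAC (B j i)).
rewrite qformE.
transitivity (- 2^-1 *
  (\sum_i \sum_j B i j * u i 0 * u j 0 * (x i 0 / u i 0) ^+ 2
  + \sum_i \sum_j B i j * u i 0 * u j 0 * (x j 0 / u j 0) ^+ 2
  - 2 * \sum_i \sum_j B i j * x i 0 * x j 0)).
  by rewrite diag0 diag0'; field.
congr (_ * _).
rewrite mulr_sumr -big_split -sumrB /=; apply: eq_bigr => i _.
rewrite mulr_sumr -big_split -sumrB /=; apply: eq_bigr => j _.
by have := u_neq0 i; have := u_neq0 j; move=> *; field; apply/andP.
Qed.

Hypothesis B_offdiag : forall i j, i != j -> B i j <= 0.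

Lemma qform_term_le0 (x : 'cV[R]_n) i j :
  B i j * u i 0 * u j 0 * (x i 0 / u i 0 - x j 0 / u j 0) ^+ 2 <= 0.
Proof.
have [-> | /B_offdiag Bij] := eqVneq i j; first by rewrite subrr expr0n mulr0.
apply: mulr_le0_ge0; last exact: sqr_ge0.
by do 2!(apply: mulr_le0_ge0; last exact: ltW).
Qed.

Lemma qform_ge0 (x : 'cV[R]_n) : 0 <= qform B x.
Proof.
rewrite qform_sum_sqr mulNr oppr_ge0 mulr_ge0_le0 ?invr_ge0 //.
by do 2!(apply: sumr_le0 => ? _); apply: qform_term_le0.
Qed.

Hypothesis B_conn : forall i j, connect [rel a b | B a b != 0] i j.

(** A vanishing sum of terms of the same sign vanishes termwise, so x / u takes
    equal values at the ends of each edge, hence along each path. *)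
Lemma qform_eq0_collinear (x : 'cV[R]_n) i j :
  qform B x = 0 -> x i 0 / u i 0 = x j 0 / u j 0.
Proof.
move=> /eqP; rewrite qform_sum_sqr mulf_eq0 oppr_eq0 invr_eq0 pnatr_eq0 /=.
rewrite -oppr_eq0 -sumrN psumr_eq0 => [/allP all0|a _]; last first.
  by rewrite oppr_ge0; apply: sumr_le0 => b _; apply: qform_term_le0.
have edge a b : B a b != 0 -> x a 0 / u a 0 = x b 0 / u b 0.
  move=> Bab; have := all0 a (mem_index_enum _).
  rewrite implyTb -sumrN psumr_eq0 => [/allP/(_ b (mem_index_enum _))|c _].
    rewrite implyTb oppr_eq0 mulf_eq0 sqrf_eq0 !mulf_eq0 (negPf Bab).
    by rewrite (gt_eqF (u_gt0 a)) (gt_eqF (u_gt0 b)) subr_eq0 => /eqP.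
  by rewrite oppr_ge0 qform_term_le0.
have /connectP[p] := B_conn i j.
elim: p i => [|a p IHp] i /= => [_ -> //|/andP[/edge -> ap] jE].
exact: IHp.
Qed.

Lemma qform_eq0_zero (x : 'cV[R]_n) i :
  qform B x = 0 -> x i 0 = 0 -> x = 0.
Proof.
move=> qx0 xi0; apply/matrixP => j z; rewrite ord1 mxE.
have /eqP := qform_eq0_collinear j i qx0.
by rewrite xi0 mul0r mulf_eq0 invr_eq0 (gt_eqF (u_gt0 j)) orbF => /eqP.
Qed.

(** B being symmetric, its row kernel consists of zeros of its quadratic form,
    hence of multiples of u. The index i0 excludes the empty matrix, which does
    not have corank one. *)
Lemma positive_kernel_corank1 (i0 : 'I_n) : (\rank B).+1 = n.
Proof.
have ker_u : (kermx B :=: u^T)%MS.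
  apply/eqmxP/andP; split; last first.
    by rewrite sub_kermx -{1}B_sym -trmx_mul Bu0 trmx0.
  apply/row_subP => a; set y := row a _.
  have yB : y *m B = 0 by apply/sub_kermxP; apply: row_sub.
  have q0 : qform B y^T = 0 by rewrite /qform trmxK yB mul0mx mxE.
  have -> : y = (y 0 i0 / u i0 0) *: u^T.
    apply/rowP => j; rewrite !mxE.
    have := qform_eq0_collinear i0 j q0; rewrite !mxE => ->.
    by rewrite divfK ?gt_eqF.
  exact: scalemx_sub.
have := mxrank_ker B; rewrite ker_u mxrank_tr.
have -> : \rank u = 1%N.
  apply/eqP; rewrite eqn_leq rank_leq_col lt0n mxrank_eq0.
  by apply/eqP => /matrixP/(_ i0 0)/eqP; rewrite mxE gt_eqF.
by move=> n_rank; rewrite -[RHS](subnKC (rank_leq_row B)) -n_rank addn1.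
Qed.

(** The principal submatrix on J is P B P^T, where P selects the coordinates in
    J; its form is that of B on vectors extended by zero outside J. *)
Lemma qform_principal (J : {set 'I_n}) (y : 'cV[R]_#|J|) :
  qform (principal_submx B J) y =
  qform B ((rowsub (@enum_val _ (mem J)) 1%:M)^T *m y).
Proof.
rewrite /qform /principal_submx mxsubrc rowsubE.
have -> : colsub (@enum_val _ (mem J)) B =
          B *m (rowsub (@enum_val _ (mem J)) 1%:M)^T.
  by rewrite trmx_mxsub trmx1 mulmx_colsub mulmx1.
by rewrite trmx_mul trmxK !mulmxA.
Qed.

Lemma positive_kernel_affine (i0 : 'I_n) : affine_type B.
Proof.
split; [by split; last exact: qform_ge0 | exact: positive_kernel_corank1 i0 |].
move=> J /properP[_ [i _ iNJ]]; split.
  by rewrite /principal_submx trmx_mxsub B_sym.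
move=> y; apply: contraNT; rewrite -leNgt qform_principal.
set P := rowsub _ _; set x := P^T *m y => qx_le0.
have qx0 : qform B x = 0 by apply/eqP; rewrite eq_le qx_le0 qform_ge0.
(* Extension by zero is injective, which transports x = 0 back to y = 0. *)
have PPt : P *m P^T = 1%:M.
  apply/matrixP => a b; rewrite /P trmx_mxsub trmx1 mulmx_colsub mulmx1 !mxE.
  by rewrite (inj_eq enum_val_inj).
have x0 : x = 0.
  apply: (qform_eq0_zero (i := i)) => //.
  rewrite mxE big1 // => a _; rewrite !mxE.
  case: eqP => [ei|]; last by rewrite mul0r.
  by case/negP: iNJ; rewrite -ei enum_valP.
by rewrite -[y]mul1mx -PPt -mulmxA -/x x0 mulmx0.
Qed.

End PositiveKernelVector.

(** * Entries of block matrices by block and position *)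

Section BlockEntries.
Variables (V : zmodType) (p : nat) (p_ : 'I_p -> nat).

Lemma mxdiag_Rank (B_ : forall i, 'M[V]_(p_ i)) i a b :
  (\mxdiag_i B_ i) (tagnat.Rank i a) (tagnat.Rank i b) = B_ i a b.
Proof. by have /matrixP/(_ a b) := submxblock_diag B_ i; rewrite mxE. Qed.

Lemma mxdiag_Rank_neq (B_ : forall i, 'M[V]_(p_ i)) i j a b : i != j ->
  (\mxdiag_i B_ i) (tagnat.Rank i a) (tagnat.Rank j b) = 0.
Proof.
move=> ij.
pose C i j := if i == j then conform_mx 0 (B_ i) else 0 : 'M_(p_ i, p_ j).
have /matrixP/(_ a b) := mxblockK C i j.
by rewrite mxE /C (negPf ij) [RHS]mxE.
Qed.

Lemma mxcol_Rank q (C_ : forall i, 'M[V]_(p_ i, q)) i a b :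
  (\mxcol_i C_ i) (tagnat.Rank i a) b = C_ i a b.
Proof. by have /matrixP/(_ a b) := mxcolK C_ i; rewrite mxE. Qed.

(** Through this induction principle, an index of a block matrix is handled as a
    block together with a position in it; a single rewriting with the inverse
    bijection would leave positions whose type depends on the index. *)
Lemma Rank_ind (P : 'I_(\sum_i p_ i) -> Prop) :
  (forall i a, P (tagnat.Rank i a)) -> forall s, P s.
Proof. by move=> PR s; rewrite -(tagnat.sig2K s). Qed.
End BlockEntries.

Lemma sum_mxcol (V : zmodType) p (p_ : 'I_p -> nat)
    (C_ : forall i, 'cV[V]_(p_ i)) :
  \sum_s (\mxcol_i C_ i) s 0 = \sum_i \sum_a C_ i a 0.
Proof.
rewrite sig_big_dep /= (reindex _ tagnat.rank_bij_on) /=.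
by apply: eq_bigr => -[i a] _; rewrite tagnat.rankE mxcol_Rank.
Qed.

(** * Linear vectors on one arm *)

Section Arm.
Variable r : nat.

(** Each term is, as b varies, supported at one point; the last one is absent in
    the first row. This lets a row be summed as three one-term sums. *)
Lemma cartanAE (a b : 'I_r) :
  cartanA r a b = (if b == a :> nat then 2 else 0)
    - (if b == a.+1 :> nat then 1 else 0)
    - (if (0 < a)%N && (b == a.-1 :> nat) then 1 else 0).
Proof.
by rewrite mxE -val_eqE /=; do !case: ifP => ?; lia.
Qed.

(** The row of a is 2 (a + 1) - a - (a + 2) = 0. In the first row the missing
    neighbour would have the value 0; in the last one it is the central vertex,
    whose value c (r + 1) enters through the arm vector. *)
Lemma cartanA_linear (c : int) :
  cartanA r *m \col_(j < r) (c * j.+1%:Z) + arm_vec r *m (c * r.+1%:Z)%:M = 0.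
Proof.
apply/matrixP => a z; rewrite ord1 [RHS]mxE mxE mul_mx_scalar !mxE.
have -> : \sum_j cartanA r a j * (\col_(j < r) (c * j.+1%:Z)) j 0 =
  2 * (c * a.+1%:Z) - (if (a.+1 < r)%N then c * a.+2%:Z else 0) - c * a%:Z.
  under eq_bigr => b _ do rewrite cartanAE mxE !mulrBl.
  rewrite !sumrB; congr (_ - _ - _).
  - rewrite (bigD1 a) //= eqxx big1 ?addr0 // => b ba.
    by rewrite ifN ?mul0r.
  - case: ifP => ar; last first.
      rewrite big1 // => b _; rewrite ifN ?mul0r //.
      by apply/eqP => bE; rewrite -bE ltn_ord in ar.
    rewrite (bigD1 (Ordinal ar)) //= eqxx mul1r big1 ?addr0 // => b ba.
    by rewrite ifN ?mul0r.
  - case: a => [[|a] ha] /=.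
      by rewrite mulr0 big1 // => b _; rewrite mul0r.
    rewrite (bigD1 (Ordinal (ltnW ha))) //= eqxx mul1r big1 ?addr0 // => b ba.
    by rewrite ifN ?mul0r.
by have := ltn_ord a; do 2!case: ifP => ?; lia.
Qed.

Lemma arm_vec_linear (c : int) :
  (arm_vec r)^T *m \col_(j < r) (c * j.+1%:Z) = (- (c * r%:Z))%:M.
Proof.
apply/matrixP => x y; rewrite !ord1 !mxE /= mulr1n.
case: r => [|n]; first by rewrite big_ord0 mulr0 oppr0.
rewrite (bigD1 ord_max) //= !mxE eqxx mulN1r big1 ?addr0 // => j jn.
by rewrite !mxE eqSS ifN ?mul0r.
Qed.

End Arm.

(** * The star *)

Section Star.
Variables (m : nat) (r : 'I_m -> nat).
Local Notation s := (star_lcm r).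
Local Notation step i := (s %/ (r i).+1)%N.

Lemma star_lcm_gt0 : (0 < s)%N.
Proof.
by rewrite /star_lcm; elim/big_ind: _ => // a b; rewrite lcmn_gt0 => -> ->.
Qed.

Lemma stepK i : (step i * (r i).+1 = s)%N.
Proof. by rewrite divnK // (biglcmn_sup i). Qed.

Lemma step_gt0 i : (0 < step i)%N.
Proof. by have := star_lcm_gt0; rewrite -{1}(stepK i) muln_gt0 => /andP[]. Qed.

(** If d divides all s / N_i then s / d is a common multiple of the N_i. The
    index i0 excludes the empty family, for which every d qualifies. *)
Lemma gcd_steps (d : nat) (i0 : 'I_m) : (forall i, d %| step i)%N -> d = 1%N.
Proof.
move=> d_step; have d_s : (d %| s)%N by rewrite -(stepK i0) dvdn_mulr.
have d_gt0 : (0 < d)%N := dvdn_gt0 star_lcm_gt0 d_s.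
have s_dvd : (s %| s %/ d)%N.
  apply/dvdn_biglcmP => i _.
  have /dvdnP[q qE] := d_step i.
  by rewrite -(stepK i) qE mulnAC mulnK // dvdn_mull.
have sd_gt0 : (0 < s %/ d)%N.
  by rewrite (divn_gt0 _ d_gt0) (dvdn_leq star_lcm_gt0).
have := dvdn_leq sd_gt0 s_dvd; rewrite leqNgt; apply: contraNeq => d_neq1.
by apply: (ltn_Pdiv _ star_lcm_gt0); rewrite ltn_neqAle eq_sym d_neq1.
Qed.

Lemma star_vec_arm i (a : 'I_(r i)) :
  star_vec r (lshift 1 (tagnat.Rank i a)) 0 = (step i * a.+1)%N.
Proof. by rewrite col_mxEu mxcol_Rank mxE. Qed.

Lemma star_vec_centre : star_vec r (rshift _ 0) 0 = s.
Proof. by rewrite col_mxEd mxE mulr1n. Qed.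

Lemma star_ind (P : 'I_(\sum_i r i + 1) -> Prop) :
  (forall i a, P (lshift 1 (tagnat.Rank i a))) -> P (rshift _ 0) ->
  forall x, P x.
Proof.
move=> Parm Pc x; case: (split_ordP x) => y ->; last by rewrite ord1.
by move: y; apply: Rank_ind.
Qed.

Lemma star_vec_gt0 x : 0 < star_vec r x 0.
Proof.
move: x; apply: star_ind => [i a|].
  by rewrite star_vec_arm ltz_nat muln_gt0 step_gt0.
by rewrite star_vec_centre ltz_nat star_lcm_gt0.
Qed.

Lemma star_vec_primitive (i0 : 'I_m) : (forall i, 0 < r i)%N ->
  \big[gcdn/0%N]_x `|star_vec r x ord0|%N = 1%N.
Proof.
move=> r_gt0; apply: (gcd_steps i0) => i.
apply: (biggcdn_inf (lshift 1 (tagnat.Rank i (Ordinal (r_gt0 i))))) => //.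
by rewrite star_vec_arm muln1.
Qed.

Variable k : nat.

Lemma star_mx_sym : (star_mx k r)^T = star_mx k r.
Proof.
rewrite /star_mx tr_block_mx trmxK tr_scalar_mx tr_mxdiag.
congr block_mx; apply: eq_mxdiag => i.
by apply/matrixP => a b; rewrite !mxE orbC eq_sym.
Qed.

Lemma star_mx_offdiag x y : x != y -> star_mx k r x y <= 0.
Proof.
have arm_le0 i a b : (arm_vec (r i)) a b <= 0 by rewrite mxE; case: ifP.
move: x y; apply: star_ind => [i a|]; apply: star_ind => [j b|].
- rewrite block_mxEul (inj_eq (@lshift_inj _ _)).
  have [ij|ij _] := eqVneq i j; last by rewrite mxdiag_Rank_neq.
  subst j.
  rewrite -val_eqE /= tagnat.eq_Rank eqxx /= mxdiag_Rank mxE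
    -val_eqE => /negPf ->.
  by case: ifP.
- by rewrite block_mxEur mxcol_Rank.
- by rewrite block_mxEdl mxE mxcol_Rank.
- by rewrite eqxx.
Qed.

(** Outward vertices are joined to the centre one step at a time, by induction
    on the distance r_i - a to the centre. *)
Lemma star_connected x y : connect [rel a b | star_mx k r a b != 0] x y.
Proof.
have e_sym : connect_sym [rel a b | star_mx k r a b != 0].
  by apply: sym_connect_sym => a b /=; rewrite -{1}star_mx_sym mxE.
suff to_centre z : connect [rel a b | star_mx k r a b != 0] z (rshift _ 0).
  by apply: connect_trans (to_centre x) _; rewrite e_sym to_centre.
move: z; apply: star_ind => // i a.
have [t] := ubnP (r i - a)%N; elim: t a => // t IHt a ta.
have := ltn_ord a; rewrite leq_eqVlt => /orP[ar|ar].
  by apply: connect1; rewrite /= block_mxEur mxcol_Rank mxE ar.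
apply: connect_trans (connect1 _) (IHt (Ordinal ar) _); last by rewrite /=; lia.
by rewrite /= block_mxEul mxdiag_Rank mxE -val_eqE /= eqxx ltn_eqF.
Qed.

Hypothesis r_sum :
  \sum_(i < m) ((r i).+1%:R)^-1 = m%:R - k%:R :> rat.

(** The central row of the kernel equation, and the only place where the sum of
    the inverses of the N_i matters: (s / N_i) r_i = s - s / N_i. *)
Lemma central_equation : (\sum_i step i * r i = k * s)%N.
Proof.
have step_rat i : (step i)%:R = s%:R * ((r i).+1%:R)^-1 :> rat.
  by rewrite -{2}(stepK i) natrM mulfK ?pnatr_eq0.
apply/eqP; rewrite -(eqr_nat rat) natr_sum natrM.
under eq_bigr => i _.
  have -> : (step i * r i)%:R = s%:R - s%:R * ((r i).+1%:R)^-1 :> rat.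
    by rewrite -step_rat -{2}(stepK i) mulnS natrD addrC addKr.
  over.
rewrite sumrB -mulr_sumr r_sum sumr_const card_ord -mulr_natr.
by apply/eqP; ring.
Qed.

Lemma star_vec_kernel : star_mx k r *m star_vec r = 0.
Proof.
rewrite /star_mx /star_vec.
have -> : \mxcol_i \col_(j < r i) (star_coord r i j.+1)%:Z =
          \mxcol_i \col_(j < r i) ((step i)%:Z * j.+1%:Z).
  by apply: eq_mxcol => i; apply/matrixP => a b; rewrite !mxE PoszM.
rewrite mul_block_col mul_mxdiag_mxcol mxcol_mul -mxcolD tr_mxcol.
rewrite mul_mxrow_mxcol.
rewrite -[RHS]vsubmxK !linear0; congr col_mx.
  rewrite -[RHS](mxcol0 (p_ := r)); apply: eq_mxcol => i.
  by rewrite -{2}(stepK i) PoszM cartanA_linear.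
under eq_bigr do rewrite arm_vec_linear.
rewrite -raddf_sum -scalar_mxM -raddfD /= sumrN -PoszM -central_equation.
rewrite (_ : \sum_i _ = (\sum_i step i * r i)%N%:Z) ?addNr ?raddf0 //.
by rewrite -natz natr_sum; apply: eq_bigr => i _; rewrite natz PoszM.
Qed.

Lemma star_coxeter_labels (R : realType) (i0 : 'I_m) :
  (forall i, 0 < r i)%N -> coxeter_labels R (star_mx k r) (star_vec r).
Proof.
move=> r_gt0; split; last exact: star_vec_primitive.
- apply: (@positive_kernel_affine _ _ _ (map_mx intr (star_vec r))).
  + by rewrite map_trmx star_mx_sym.
  + by move=> x; rewrite mxE ltr0z star_vec_gt0.
  + by rewrite -map_mxM star_vec_kernel map_mx0.
  + by move=> x y xy; rewrite mxE lerz0 star_mx_offdiag.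
  + move=> x y; rewrite (eq_connect (e' := [rel a b | star_mx k r a b != 0])).
      exact: star_connected.
    by move=> a b; rewrite /= mxE intr_eq0.
  + exact: (rshift _ 0).
- exact: star_vec_kernel.
- exact: star_vec_gt0.
Qed.

Lemma sum_star_vec :
  \sum_x star_vec r x ord0 =
  (s + \sum_(i < m) \sum_(1 <= j < (r i).+1) star_coord r i j)%N.
Proof.
rewrite big_split_ord /= big_ord1 star_vec_centre addrC PoszD; congr (_ + _).
under eq_bigr do rewrite col_mxEu.
rewrite sum_mxcol -natz natr_sum; apply: eq_bigr => i _.
rewrite natr_sum big_add1 /= big_mkord; apply: eq_bigr => a _.
by rewrite mxE natz.
Qed.

(** By Gauss' sum, (s / N_i) r_i (r_i + 1) / 2, in which N_i = r_i + 1
    cancels. *)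
Lemma sum_star_coord i :
  (\sum_(1 <= j < (r i).+1) star_coord r i j)%:R =
  s%:R * (2^-1 * (r i)%:R) :> rat.
Proof.
have gauss n : (\sum_(1 <= j < n.+1) j)%:R = n.+1%:R * (2^-1 * n%:R) :> rat.
  elim: n => [|n IHn]; first by rewrite big_geq // !mulr0.
  by rewrite big_nat_recr //= natrD IHn; field.
by rewrite /star_coord -big_distrr natrM gauss (mulrA (step i)%:R) -natrM stepK.
Qed.

End Star.

Theorem proposition6p1 (R : realType) (m : nat) (r : 'I_m -> nat) (k : nat)
    (hm : (2 <= m)%N) (hr : forall i, (0 < r i)%N) (hk : (0 < k)%N)
    (hsum : \sum_(i < m) ((r i).+1%:R)^-1 = m%:R - k%:R :> rat) :
  let B := star_mx k r in
  let D := (1 + \sum_(i < m) r i)%N in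
  let s := star_lcm r in
  let h := (s + \sum_(i < m) \sum_(1 <= j < (r i).+1) star_coord r i j)%N in
  (exists v : 'cV[int]_(\sum_i r i + 1), exists d : nat,
     [/\ coxeter_labels R B v, (0 < d)%N & star_vec r = d%:Z *: v])
  /\ [/\ coxeter_number R B h%:Z,
         h%:R = s%:R * (1 + 2^-1 * \sum_(i < m) (r i)%:R) :> rat
       & s%:R * (1 + 2^-1 * \sum_(i < m) (r i)%:R) = s%:R / 2 * (D%:R + 1)
           :> rat].
Proof.
move=> B D s h.
(* The vector is primitive, so the common divisor d is 1. *)
have labels : coxeter_labels R B (star_vec r).
  exact: star_coxeter_labels hsum R (Ordinal (ltnW hm)) hr.
split; first by exists (star_vec r), 1%N; split; rewrite ?scale1r.
split.
- by exists (star_vec r); rewrite // sum_star_vec.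
- rewrite natrD natr_sum mulrDr mulr1 mulr_sumr mulr_sumr; congr (_ + _).
  by apply: eq_bigr => i _; rewrite sum_star_coord.
- by rewrite natrD natr_sum; field.
Qed.
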